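(* Any finite group $G$ of order $n$ is isomorphic to a realisable subgroup of $\mathcal P((1+k)n)$, where $k$ is the number of disjoint cycles of the permutation $\sigma_2\in S_n$ attached to $G=\{g_1,\dots,g_n\}$ by Cayley's theorem.
   Context: For $m\ge 1$, $\mathcal P(m)$ denotes the group of permutation matrices of order $m$ and $S_m$ the symmetric group on $\{1,\dots,m\}$. A subgroup $H$ of $\mathcal P(m)$ is called realisable if each element $M\in H$ is obtained by permuting the rows of the identity matrix $I_m$ using a permutation $\tau\in S_m$ satisfying $\tau(i)\neq i$ for all $1\le i\le m$. Write $G=\{g_1,\dots,g_n\}$. Cayley's theorem gives the monomorphism $G\to S_n$, $g_j\mapsto\sigma_j$, where $\sigma_j$ is left multiplication $g_i\mapsto g_jg_i$, regarded as a permutation of the indices $1,\dots,n$; the elements are numbered so that $\sigma_j(1)=j$. The number $k$ is given by the decomposition $\sigma_2=\tau_1\tau_2\cdots\tau_k$ of $\sigma_2$ into a product of disjoint cycles.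
   Formalization: The fixed-point-free condition in ''realisable'' is required only of the non-identity elements of H, since the identity matrix arises only from the identity permutation; and n is at least 2, so that the permutation attached to the second element exists. *)

(* Defs.v *)
From HB Require Import structures.
From mathcomp Require Import all_boot all_order all_algebra all_fingroup.

Set Implicit Arguments.
Unset Strict Implicit.
Unset Printing Implicit Defensive.

Import GRing.Theory.
Local Open Scope ring_scope.

(* The group P(m) of permutation matrices of order m, as a finGroupType.  Its
   law is the matrix product; the inverse of a permutation matrix is its
   transpose.  The coefficient ring R is any nontrivial ring. *)
Record permMx (R : nzRingType) (m : nat) := PermMx {
  permMx_val :> 'M[R]_m;
  permMxP : is_perm_mx permMx_val
}.

HB.instance Definition _ R m := [isSub for @permMx_val R m].
HB.instance Definition _ R m := [Choice of permMx R m by <:].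

Section PermMxGroup.

Variables (R : nzRingType) (m : nat).
Implicit Types M N : permMx R m.

Lemma permMx_ex M : exists s, permMx_val M == perm_mx s.
Proof. by case/is_perm_mxP: (permMxP M) => s ->; exists s. Qed.

Let to_perm M : 'S_m := xchoose (permMx_ex M).
Let of_perm (s : 'S_m) : permMx R m := PermMx (perm_mx_is_perm R s).

Lemma permMx_to_permK : cancel to_perm of_perm.
Proof. by move=> M; apply/val_inj/esym/eqP/(xchooseP (permMx_ex M)). Qed.

HB.instance Definition _ : isCountable (permMx R m) :=
  CanIsCountable permMx_to_permK.
HB.instance Definition _ : isFinite (permMx R m) := CanIsFinite permMx_to_permK.

Lemma permMx_mul_subproof M N : is_perm_mx (permMx_val M *m permMx_val N).
Proof. by rewrite (is_perm_mxMl _ (permMxP M)) permMxP. Qed.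

Lemma permMx_inv_subproof M : is_perm_mx (permMx_val M)^T.
Proof. by rewrite is_perm_mx_tr permMxP. Qed.

Definition permMx_mul M N := PermMx (permMx_mul_subproof M N).
Definition permMx_one : permMx R m := PermMx (is_perm_mx1 R m).
Definition permMx_inv M := PermMx (permMx_inv_subproof M).

Lemma permMx_mulA : associative permMx_mul.
Proof. by move=> M N P; apply/val_inj; rewrite /= mulmxA. Qed.

Lemma permMx_mul1 : left_id permMx_one permMx_mul.
Proof. by move=> M; apply/val_inj; rewrite /= mul1mx. Qed.

Lemma permMx_mulV : left_inverse permMx_one permMx_inv permMx_mul.
Proof.
move=> M; apply/val_inj => /=; case/is_perm_mxP: (permMxP M) => s ->.
by rewrite tr_perm_mx -perm_mxM mulVg perm_mx1.
Qed.

HB.instance Definition _ := Finite_isGroup.Build (permMx R m)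
  permMx_mulA permMx_mul1 permMx_mulV.

End PermMxGroup.

(* The requirement is imposed on the elements other than the identity: the only
   permutation producing I_m from I_m is the identity, which fixes every
   index. *)
Definition realisable (R : nzRingType) (m : nat)
    (H : {group permMx R m}) : Prop :=
  forall M : permMx R m, M \in H -> M != 1%g ->
    exists tau : 'S_m,
      (forall i : 'I_m, tau i != i) /\
      permMx_val M = row_perm tau 1%:M.

(* A listing G = {g_1, ..., g_n} without repetition; the indices 1, ..., n of
   the listing are the elements 0, ..., n-1 of 'I_n. *)
Record numbering (gT : finGroupType) (G : {group gT}) (n : nat) := Numbering {
  numbered :> 'I_n -> gT;
  numbered_inj : injective numbered;
  numbered_im : numbered @: [set: 'I_n] = G
}.

Section Cayley.

Variables (gT : finGroupType) (G : {group gT}) (n : nat).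
Variables (g : numbering G n).

Lemma numbered_in i : g i \in G.
Proof. by rewrite -(numbered_im g) imset_f ?inE. Qed.

Lemma cayley_subproof j i : exists k, g k == (g j * g i)%g.
Proof.
have: (g j * g i)%g \in G by rewrite groupM ?numbered_in.
by rewrite -(numbered_im g) => /imsetP [k _ ->]; exists k.
Qed.

Definition cayley_index (j i : 'I_n) : 'I_n := xchoose (cayley_subproof j i).

Lemma cayley_indexE j i : g (cayley_index j i) = (g j * g i)%g.
Proof. exact/eqP/(xchooseP (cayley_subproof j i)). Qed.

Lemma cayley_index_inj j : injective (cayley_index j).
Proof.
move=> i1 i2 /(congr1 g); rewrite !cayley_indexE => /mulgI.
exact: numbered_inj.
Qed.

Definition cayley_perm (j : 'I_n) : 'S_n := perm (@cayley_index_inj j).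

Lemma cayley_permE j i : g (cayley_perm j i) = (g j * g i)%g.
Proof. by rewrite permE cayley_indexE. Qed.

End Cayley.

(* Main.v *)
Require Import Defs.
From mathcomp Require Import all_boot all_order all_algebra all_fingroup.

(** In the regular action of a group on itself by translation, an element other
than the identity moves every point.  The same is true of any nonzero number of
disjoint copies of this action: [1 + k] copies of the regular action of [G] form
a free action on a set of cardinal [(1 + k) * n], and the permutation matrices
of a free action, on any numbering of the points, are a realisable group
([free_action_realisable]).  A free action on a nonempty set is faithful, so this
group is isomorphic to [G].

Products of permutations are read from left to right, and [perm_mx] is
multiplicative for this convention, hence right translations are the ones that
give a morphism. *)

Set Implicit Arguments.
Unset Strict Implicit.
Unset Printing Implicit Defensive.

Lemma perm_mx_inj (R : nzRingType) (m : nat) : injective (@perm_mx R m).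
Proof.
move=> s t /matrixP eq_st; apply/permP=> i; have := eq_st i (s i).
rewrite !mxE eqxx; case: eqP => [-> // | _ /eqP]; by rewrite GRing.oner_eq0.
Qed.

Section ActionMatrices.

Import GroupScope.

Variables (R : nzRingType) (hT : finGroupType) (T : finType).
Variable to : {action hT &-> T}.

Lemma ord_act_inj a :
  injective (fun i : 'I_#|T| => enum_rank (to (enum_val i) a)).
Proof. by move=> i j /enum_rank_inj /act_inj /enum_val_inj. Qed.

Definition ord_act a : 'S_#|T| := perm (@ord_act_inj a).

Lemma ord_actM : {morph ord_act : a b / a * b}.
Proof. by move=> a b; apply/permP=> i; rewrite permM !permE enum_rankK actM. Qed.

Definition act_permMx a : permMx R #|T| :=
  PermMx (perm_mx_is_perm R (ord_act a)).

Lemma act_permMxM : {in [set: hT] &, {morph act_permMx : a b / a * b}}.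
Proof. by move=> a b _ _; apply/val_inj; rewrite /= ord_actM perm_mxM. Qed.

Canonical act_permMx_morphism := Morphism act_permMxM.

Hypothesis free : forall a x, to x a = x -> a = 1.

Lemma ord_act_free a i : a != 1 -> ord_act a i != i.
Proof.
apply: contraNneq; rewrite permE => /(congr1 enum_val); rewrite enum_rankK.
by move/free->.
Qed.

(** Equal matrices come from equal permutations of the points, and by freeness
one point already tells apart the permutations of distinct group elements; [x0]
is this point. *)
Lemma free_action_realisable (x0 : T) :
  exists H : {group permMx R #|T|}, realisable H /\ [set: hT] \isog H.
Proof.
exists (act_permMx @* [set: hT])%G; split.
  move=> M /morphimP[a _ _ ->{M}] a_act; exists (ord_act a); split=> // i.
  by apply: ord_act_free; apply: contraNneq a_act => ->; rewrite morph1.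
apply: sub_isog => //; apply/injmP=> a b _ _ /(congr1 val) /= /perm_mx_inj.
move/permP/(_ (enum_rank x0)); rewrite !permE => /enum_rank_inj.
rewrite enum_rankK => eq_ab; apply/eqP; rewrite eq_mulgV1; apply/eqP.
by apply: (free (x := x0)); rewrite actM eq_ab actK.
Qed.

End ActionMatrices.

Section TranslationCopies.

Import GroupScope.

Variables (I : finType) (hT : finGroupType).

Definition copies_act (x : I * hT) (a : hT) := (x.1, x.2 * a).

Lemma copies_act1 x : copies_act x 1 = x.
Proof. by case: x => i y; rewrite /copies_act mulg1. Qed.

Lemma copies_actM x : act_morph copies_act x.
Proof. by move=> a b; rewrite /copies_act mulgA. Qed.

Definition copies_action := TotalAction copies_act1 copies_actM.

Lemma copies_action_free a x : copies_action x a = x -> a = 1.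
Proof. by case: x => i y [] /(canRL (mulKg y)); rewrite mulVg. Qed.

End TranslationCopies.

Theorem corollary2 (R : nzRingType) (gT : finGroupType) (G : {group gT})
    (n : nat) (cardG : #|G| = n) (n_gt1 : (1 < n)%N)
    (g : numbering G n)
    (sigma1 : forall j : 'I_n, cayley_perm g j (Ordinal (ltnW n_gt1)) = j)
    (k : nat) (k_def : k = #|porbits (cayley_perm g (Ordinal n_gt1))|) :
  exists H : {group permMx R ((1 + k) * n)},
    realisable H /\ G \isog H.
Proof.
have cardT : #|{: 'I_(1 + k) * subg_of G}| = ((1 + k) * n)%N.
  by rewrite card_prod card_ord -(cardsT (subg_of G)) -(card_isog (isog_subg G)) cardG.
have [H [realH isoH]] :=
  @free_action_realisable R _ _ (copies_action 'I_(1 + k) (subg_of G))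
    (@copies_action_free _ _) (ord0, 1%g).
rewrite -cardT; exists H; split=> //.
by apply: isog_trans isoH; apply: isog_subg.
Qed.
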